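(* Let $A=\sigma(R)\langle x_1,\dots,x_n\rangle$ be a bijective skew PBW extension of a right Gröbner soluble ring $R$, let $m\ge 1$, and let $\mathrm{Mon}(A)$ and $\mathrm{Mon}(A^m)$ each be endowed with a monomial order, as defined in the context. Let $F=\{\mathbf f_1,\dots,\mathbf f_t\}$ be a set of non-zero vectors of $A^m$ and let $\mathbf f\in A^m$. Then the right division algorithm (described in the context), applied to $\mathbf f,\mathbf f_1,\dots,\mathbf f_t$, produces polynomials $q_1,\dots,q_t\in A$ and a vector $\mathbf h\in A^m$, reduced with respect to $F$, such that $\mathbf f\xrightarrow{F}_{+}\mathbf h$ and $$\mathbf f=\mathbf f_1q_1+\cdots+\mathbf f_tq_t+\mathbf h,$$ with $$\mathrm{lm}(\mathbf f)=\max\{\mathrm{lm}(\mathrm{lm}(\mathbf f_1)\mathrm{lm}(q_1)),\dots,\mathrm{lm}(\mathrm{lm}(\mathbf f_t)\mathrm{lm}(q_t)),\mathrm{lm}(\mathbf h)\}.$$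
   Context: **Skew PBW extensions.** Rings are associative with $1$. Let $R\subseteq A$ be rings. $A$ is a skew PBW extension of $R$, written $A=\sigma(R)\langle x_1,\dots,x_n\rangle$, if there are $x_1,\dots,x_n\in A$ such that: $A$ is a free left $R$-module with basis $\mathrm{Mon}(A)=\{x^\alpha:=x_1^{\alpha_1}\cdots x_n^{\alpha_n}\mid\alpha\in\mathbb N^n\}$; for every $i$ and $0\ne r\in R$ there is $c_{i,r}\in R\setminus\{0\}$ with $x_ir-c_{i,r}x_i\in R$; for all $i,j$ there is $c_{i,j}\in R\setminus\{0\}$ with $x_jx_i-c_{i,j}x_ix_j\in R+Rx_1+\cdots+Rx_n$. Then there are injective ring endomorphisms $\sigma_i$ of $R$ and $\sigma_i$-derivations $\delta_i$ with $x_ir=\sigma_i(r)x_i+\delta_i(r)$ for all $r\in R$. $A$ is bijective if every $\sigma_i$ is bijective and every $c_{i,j}$ is invertible. Put $|\alpha|=\alpha_1+\cdots+\alpha_n$, $\deg(x^\alpha)=|\alpha|$, $\exp(x^\alpha)=\alpha$, $\sigma^\alpha=\sigma_1^{\alpha_1}\cdots\sigma_n^{\alpha_n}$ and $\sigma^{-\alpha}=(\sigma^\alpha)^{-1}$; the degree of a non-zero $f\in A$ is the largest degree of a monomial occurring in it. For $\alpha,\beta\in\mathbb N^n$, $c_{\alpha,\beta}\in R$ is the unique element with $x^\alpha x^\beta=c_{\alpha,\beta}x^{\alpha+\beta}+p_{\alpha,\beta}$, where $p_{\alpha,\beta}=0$ or $\deg p_{\alpha,\beta}<|\alpha+\beta|$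 (it is invertible when $A$ is bijective). For $\theta_1,\theta_2\in\mathbb N^n$ let $\psi_{\theta_1,\theta_2}:R\to R$ be the automorphism $\psi_{\theta_1,\theta_2}(r)=\sigma^{\theta_1+\theta_2}(\sigma^{-\theta_2}(r))$. **Right Gröbner soluble (RGS) ring.** $R$ is RGS if it is right Noetherian; there is an algorithm which, given $a,r_1,\dots,r_m\in R$, decides whether $a\in r_1R+\cdots+r_mR$ and, if so, finds $b_i\in R$ with $a=\sum r_ib_i$; and there is an algorithm which, given $r_1,\dots,r_m\in R$, finds a finite generating set of the right $R$-module $\mathrm{Syz}^r_R[r_1\cdots r_m]=\{(b_1,\dots,b_m)\in R^m\mid \sum r_ib_i=0\}$. **Monomial orders.** For a total order $\succeq$ on a set of monomials, $X\succ Y$ means $X\succeq Y$ and $X\ne Y$. A monomial order on $\mathrm{Mon}(A)$ is a total order $\succeq$ such that $x^\beta\succeq x^\alpha$ implies $\mathrm{lm}(x^\gamma x^\beta x^\lambda)\succeq\mathrm{lm}(x^\gamma x^\alpha x^\lambda)$ for all $\gamma,\lambda$; $x^\alpha\succeq1$ always; and $|\beta|>|\alpha|$ implies $x^\beta\succ x^\alpha$. $A^m$ is the free right $A$-module of vectors of length $m$ with canonical basis $\mathbf e_1,\dots,\mathbf e_m$; $\mathrm{Mon}(A^m)$ is the set of vectors $\mathbf X=x^\alpha\mathbf e_i$, with $\mathrm{ind}(\mathbf X)=i$, $\exp(\mathbf X)=\alpha$, $\deg(\mathbf X)=|\alpha|$. A monomial order on $\mathrm{Mon}(A^m)$ is a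 total order $\succeq$ such that (i) $\mathrm{lm}(x^\beta x^\alpha)\mathbf e_i\succeq x^\alpha\mathbf e_i$ for all $\alpha,\beta,i$; (ii) $x^\beta\mathbf e_j\succeq x^\alpha\mathbf e_i$ implies $\mathrm{lm}(x^\gamma x^\beta)\mathbf e_j\succeq\mathrm{lm}(x^\gamma x^\alpha)\mathbf e_i$ for all $\gamma$; (iii) $\deg\mathbf X>\deg\mathbf Y$ implies $\mathbf X\succ\mathbf Y$. (Here $\mathrm{lm}(x^\gamma x^\alpha)=x^{\gamma+\alpha}$.) Each $\mathbf f\ne\mathbf 0$ in $A^m$ is uniquely $\mathbf f=c_1\mathbf X_1+\cdots+c_k\mathbf X_k$ with $c_i\in R\setminus\{0\}$ and $\mathbf X_1\succ\cdots\succ\mathbf X_k$ monomials; $\mathrm{lm}(\mathbf f)=\mathbf X_1$, $\mathrm{lc}(\mathbf f)=c_1$; similarly in $A$, using the order on $\mathrm{Mon}(A)$. By convention $\mathrm{lm}(\mathbf 0)=\mathbf 0$, $\mathrm{lc}(\mathbf 0)=0$, and $\mathbf X\succ\mathbf 0$ for every monomial $\mathbf X$ (similarly in $A$). For $\mathbf X=x^\alpha \mathbf e_i$ and $Y=x^\beta$, $\mathbf XY=x^\alpha x^\beta\mathbf e_i$ and $\mathrm{lm}(\mathbf XY)=x^{\alpha+\beta}\mathbf e_i$. For $\mathbf f,\mathbf g\neq\mathbf 0$, $\mathrm{lm}(\mathbf g)$ divides $\mathrm{lm}(\mathbf f)$, written $\mathrm{lm}(\mathbf g)\mid\mathrm{lm}(\mathbf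 f)$, if they have the same index and $\exp(\mathrm{lm}(\mathbf g))+\alpha=\exp(\mathrm{lm}(\mathbf f))$ for some $\alpha\in\mathbb N^n$. **Reduction.** For a finite set $F$ of non-zero vectors of $A^m$ and $\mathbf f,\mathbf h\in A^m$, $\mathbf f$ reduces to $\mathbf h$ by $F$ in one step, $\mathbf f\xrightarrow{F}\mathbf h$, if there are $\mathbf f_1,\dots,\mathbf f_t\in F$ and $r_1,\dots,r_t\in R$ such that (i) $\mathrm{lm}(\mathbf f_i)\mid\mathrm{lm}(\mathbf f)$, i.e. the indices agree and there is $\alpha_i\in\mathbb N^n$ with $\beta_i+\alpha_i=\exp(\mathrm{lm}(\mathbf f))$, $\beta_i:=\exp(\mathrm{lm}(\mathbf f_i))$; (ii) $\mathrm{lc}(\mathbf f)=\sum_{i=1}^t\mathrm{lc}(\mathbf f_i)\sigma^{\beta_i}(r_i)c_{\beta_i,\alpha_i}$; (iii) $\mathbf h=\mathbf f-\sum_{i=1}^t\mathbf f_ir_ix^{\alpha_i}$. By convention $\mathbf 0\xrightarrow{F}\mathbf 0$. $\mathbf f$ reduces to $\mathbf h$ by $F$, $\mathbf f\xrightarrow{F}_+\mathbf h$, if and only if there exist vectors $\mathbf h_1,\dots,\mathbf h_{s-1}\in A^m$ such that $\mathbf f\xrightarrow{F}\mathbf h_1\xrightarrow{F}\mathbf h_2\xrightarrow{F}\cdots\xrightarrow{F}\mathbf h_{s-1}\xrightarrow{F}\mathbf h$. $\mathbf f$ is reduced with respect to $F$ if $\mathbf f=\mathbf 0$ or there is no one-step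 reduction of $\mathbf f$ by $F$, i.e. one of the conditions (i), (ii) fails. **Right division algorithm.** Input $\mathbf f,\mathbf f_1,\dots,\mathbf f_t\in A^m$ with all $\mathbf f_j\ne\mathbf 0$. Initialize $q_1=\cdots=q_t=0$, $\mathbf h=\mathbf f$. While $\mathbf h\ne\mathbf 0$ and some $\mathrm{lm}(\mathbf f_j)$ divides $\mathrm{lm}(\mathbf h)$: let $J=\{j\mid\mathrm{lm}(\mathbf f_j)\text{ divides }\mathrm{lm}(\mathbf h)\}$, and for $j\in J$ put $\beta_j=\exp(\mathrm{lm}(\mathbf f_j))$, $\alpha_j=\exp(\mathrm{lm}(\mathbf h))-\beta_j$. If the equation $\mathrm{lc}(\mathbf h)=\sum_{j\in J}\mathrm{lc}(\mathbf f_j)c_{\beta_j,\alpha_j}s_j$ is soluble in $R$, compute one solution $(s_j)_{j\in J}$ and, for each $j\in J$, set $r_j=\psi^{-1}_{\beta_j,\alpha_j}(s_j)$, $q_j\leftarrow q_j+r_jx^{\alpha_j}$, $\mathbf h\leftarrow\mathbf h-\mathbf f_jr_jx^{\alpha_j}$; otherwise stop. Output $q_1,\dots,q_t,\mathbf h$.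
   Formalization: The formula for lm(f) is proved only if the two orders are compatible (x^β ⪰ x^α in Mon(A) implies x^β e_i ⪰ x^α e_i for all i); it is false otherwise. The chain f →_+ h may have zero steps, needed when f is non-zero and already reduced. *)

(* Defs.v *)
From HB Require Import structures.
From mathcomp Require Import all_boot all_order all_algebra.
From mathcomp Require Import finmap monalg mpoly.

Set Implicit Arguments.
Unset Strict Implicit.
Unset Printing Implicit Defensive.

Import GRing.Theory.
Local Open Scope ring_scope.

(* Both monalg and mpoly define [msupp] and [_@_ _]; everywhere below they are
   the ones of monalg, i.e. those of finitely supported families
   {malg R['X_{1..n}]} of elements of R indexed by N^n. *)
Notation msupp := monalg.msupp.
Notation coef := monalg.mcoeff.

(* ------------------------------------------------------------------------ *)

Lemma bij_surj (T : Type) (U : eqType) (f : T -> U) :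
  bijective f -> forall y, exists x, f x == y.
Proof. by case=> g _ gK y; exists (g y); rewrite gK. Qed.

Definition bij_inv (T : choiceType) (U : eqType) (f : T -> U)
  (bf : bijective f) (y : U) : T := xchoose (bij_surj bf y).

Lemma bij_invKV (T : choiceType) (U : eqType) (f : T -> U)
  (bf : bijective f) : cancel (bij_inv bf) f.
Proof. by move=> y; apply/eqP/(xchooseP (bij_surj bf y)). Qed.

Lemma bij_invK (T : choiceType) (U : eqType) (f : T -> U)
  (bf : bijective f) : cancel f (bij_inv bf).
Proof. by move=> x; apply: (bij_inj bf); rewrite bij_invKV. Qed.

Lemma bij_inv_bij (T : choiceType) (U : eqType) (f : T -> U)
  (bf : bijective f) : bijective (bij_inv bf).
Proof. by exists f; [apply: bij_invKV | apply: bij_invK]. Qed.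

(* Two-sided invertibility: R carries no unitRingType structure. *)
Definition invertible (R : pzRingType) (c : R) : Prop :=
  exists d, d * c = 1 /\ c * d = 1.

(* ------------------------------------------------------------------------ *)

Section SkewPBW.
Context (R A : pzRingType) (n : nat).
Implicit Types (a b : 'X_{1..n}) (i j : 'I_n) (r : R).

Definition monomial (x : 'I_n -> A) a : A := \prod_(i < n) x i ^+ a i.

Definition lincomb (e : R -> A) (x : 'I_n -> A) (g : {malg R['X_{1..n}]}) : A :=
  \sum_(a <- msupp g) e (coef a g) * monomial x a.

(* The inclusion of R in A is the injective ring morphism [emb]. That Mon(A)
   is a basis of the left R-module A is the bijectivity of the evaluation
   R^(N^n) -> A of finitely supported families of coefficients. [cst i j] is
   the constant c_{i,j}. *)
Record skewPBW := SkewPBW {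
  emb : {rmorphism R -> A};
  var : 'I_n -> A;
  cst : 'I_n -> 'I_n -> R;
  emb_inj : injective emb;
  mon_basis : bijective (lincomb emb var);
  var_emb : forall i r, r != 0 ->
    exists c, c != 0 /\ exists d, var i * emb r - emb c * var i = emb d;
  cst_neq0 : forall i j, cst i j != 0;
  var_var : forall i j, exists d (e : 'I_n -> R),
    var j * var i - emb (cst i j) * (var i * var j)
      = emb d + \sum_(k < n) emb (e k) * var k
}.

Context (P : skewPBW).

Definition mon a : A := monomial (var P) a.

Definition coord : A -> {malg R['X_{1..n}]} := bij_inv (mon_basis P).

Lemma coordK (f : A) :
  f = \sum_(a <- msupp (coord f)) emb P (coef a (coord f)) * mon a.
Proof. exact/esym/(bij_invKV (mon_basis P)). Qed.

Lemma lincombEw (e : {rmorphism R -> A}) x (g : {malg R['X_{1..n}]}) D :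
  fsubset (msupp g) D ->
  lincomb e x g = \sum_(a <- D) e (coef a g) * monomial x a.
Proof.
move=> sgD; rewrite /lincomb (big_fset_incl _ sgD) // => a _ nag.
by rewrite (mcoeff_outdom nag) raddf0 mul0r.
Qed.

Lemma lincombD (e : {rmorphism R -> A}) x (g h : {malg R['X_{1..n}]}) :
  lincomb e x (g + h) = lincomb e x g + lincomb e x h.
Proof.
pose D := fsetU (msupp g) (msupp h).
rewrite (lincombEw e x (monalg.msuppD_le g h)) (lincombEw e x (fsubsetUl _ _ : fsubset _ D)).
rewrite (lincombEw e x (fsubsetUr _ _ : fsubset _ D)) -big_split /=.
by apply: eq_bigr => a _; rewrite monalg.mcoeffD raddfD mulrDl.
Qed.

Lemma coordD (f g : A) : coord (f + g) = coord f + coord g.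
Proof.
by apply: (bij_inj (mon_basis P)); rewrite lincombD !(bij_invKV (mon_basis P)).
Qed.

Lemma coord_mon (c : R) a : coord (emb P c * mon a) = mkmalgU a c.
Proof.
apply: (bij_inj (mon_basis P)); rewrite (bij_invKV (mon_basis P)).
rewrite (lincombEw _ _ (monalg.msuppU_le (k := a) (x := c))) big_seq_fset1.
by rewrite monalg.mcoeffUU.
Qed.

Lemma mon0 : mon 0%MM = 1.
Proof. by apply: big1 => i _; rewrite mnm0E expr0. Qed.

Lemma monU i : mon U_(i)%MM = var P i.
Proof.
have E (k : 'I_n) : var P k ^+ U_(i)%MM k = if k == i then var P i else 1.
  by rewrite mnm1E; have [->|] := eqVneq k i; rewrite ?eqxx ?expr1 // eq_sym => /negbTE->.
rewrite /mon /monomial (eq_bigr _ (fun k _ => E k)) -big_mkcond /=.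
by rewrite (big_pred1 i).
Qed.

Lemma coord_emb (c : R) : coord (emb P c) = mkmalgU 0%MM c.
Proof. by rewrite -coord_mon mon0 mulr1. Qed.

Definition degA (f : A) : nat := \max_(a <- msupp (coord f)) mdeg a.

(* The coefficient of x_i in x_i r. See [sigmaP] for the characterization
   x_i r = sigma_i(r) x_i + delta_i(r). *)
Definition sigma i r : R := coef U_(i)%MM (coord (var P i * emb P r)).

Lemma sigma_unique i r s d :
  var P i * emb P r = emb P s * var P i + emb P d -> sigma i r = s.
Proof.
rewrite /sigma => ->; rewrite -monU coordD coord_mon coord_emb monalg.mcoeffD.
by rewrite !monalg.mcoeffU eqxx eq_sym mnm1_eq0 mulr1n mulr0n addr0.
Qed.

Lemma sigmaP i r :
  exists d, var P i * emb P r = emb P (sigma i r) * var P i + emb P d.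
Proof.
have [c [d E]] : exists c d, var P i * emb P r = emb P c * var P i + emb P d.
  have [->|r0] := eqVneq r 0.
    by exists 0, 0; rewrite !raddf0 mul0r mulr0 addr0.
  have [c [_ [d E]]] := var_emb P i r0.
  by exists c, d; rewrite -E addrC subrK.
by exists d; rewrite (sigma_unique E).
Qed.

(* sigma^a = sigma_1^(a_1) o ... o sigma_n^(a_n) *)
Definition sigmaX a r : R :=
  foldr (fun i => iter (a i) (sigma i)) r (enum 'I_n).

(* The coefficient of x^(a+b) in x^a x^b. See [cprod_unique]. *)
Definition cprod a b : R := coef (a + b)%MM (coord (mon a * mon b)).

Lemma cprod_unique a b c p :
  mon a * mon b = emb P c * mon (a + b)%MM + p ->
  p = 0 \/ (degA p < mdeg (a + b))%N -> cprod a b = c.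
Proof.
rewrite /cprod => -> Hp; rewrite coordD coord_mon monalg.mcoeffD monalg.mcoeffUU.
suff -> : coef (a + b)%MM (coord p) = 0 by rewrite addr0.
apply: mcoeff_outdom; case: Hp => [->|Hp].
  by rewrite -(raddf0 (emb P)) coord_emb monalgU0 monalg.msupp0.
apply/negP => ab; move: Hp; rewrite ltnNge /degA.
by rewrite (leq_bigmax_seq _ ab).
Qed.

Definition bijective_ext : Prop :=
  (forall i, bijective (sigma i)) /\ (forall i j, invertible (cst P i j)).

Lemma sigmaX_bij (hP : bijective_ext) a : bijective (sigmaX a).
Proof.
rewrite /sigmaX; elim: (enum 'I_n) => [|i s IH] /=; first by exists id.
apply: (bij_comp (f := iter (a i) (sigma i))) IH.
by elim: (a i) => [|k IH] /=; [exists id | apply: bij_comp IH; apply: hP.1].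
Qed.

Definition sigmaXV (hP : bijective_ext) a : R -> R := bij_inv (sigmaX_bij hP a).

Definition psi (hP : bijective_ext) a b r : R :=
  sigmaX (a + b)%MM (sigmaXV hP b r).

Lemma psi_bij (hP : bijective_ext) a b : bijective (psi hP a b).
Proof. exact: bij_comp (sigmaX_bij hP _) (bij_inv_bij _). Qed.

Definition psiV (hP : bijective_ext) a b : R -> R := bij_inv (psi_bij hP a b).

End SkewPBW.

(* ------------------------------------------------------------------------ *)

(* Leading monomials live in [option T], with [None] for lm(0) = 0. *)
Section Orders.
Context (T : eqType) (ge : rel T).

Definition total_order : Prop :=
  [/\ reflexive ge, antisymmetric ge, transitive ge & total ge].

Definition sgt : rel T := fun x y => ge x y && (x != y).

Definition oge (u v : option T) : bool :=
  match u, v with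
  | _, None => true
  | None, Some _ => false
  | Some x, Some y => ge x y
  end.

Definition omax (u v : option T) : option T := if oge u v then u else v.

End Orders.

Section MonomialOrders.
Context (R A : pzRingType) (n m : nat) (P : skewPBW R A n).

(* Mon(A) is N^n, with a standing for x^a; Mon(A^m) is N^n x {1..m}, with
   (a, i) standing for x^a e_i. *)
Context (geA : rel 'X_{1..n}) (geV : rel ('X_{1..n} * 'I_m)%type).
Implicit Types (a b c d : 'X_{1..n}) (i j : 'I_m) (f : 'cV[A]_m).

Definition lmA (p : A) : option 'X_{1..n} :=
  \big[omax geA/None]_(a <- msupp (coord P p)) Some a.

Definition lmV f : option ('X_{1..n} * 'I_m) :=
  \big[omax geV/None]_(i < m)
    \big[omax geV/None]_(a <- msupp (coord P (f i 0))) Some (a, i).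

Definition lcV f : R :=
  if lmV f is Some X then coef X.1 (coord P (f X.2 0)) else 0.

Definition expV f : 'X_{1..n} := if lmV f is Some X then X.1 else 0%MM.

(* The elements of A and A^m denoted by a leading monomial. *)
Definition valA (u : option 'X_{1..n}) : A :=
  if u is Some a then mon P a else 0.

Definition valV (u : option ('X_{1..n} * 'I_m)) : 'cV[A]_m :=
  if u is Some X then mon P X.1 *: delta_mx X.2 0 else 0.

Record monomial_orderA : Prop := MonomialOrderA {
  mA_total : total_order geA;
  mA_mul : forall a b c d, geA b a ->
    oge geA (lmA (mon P c * mon P b * mon P d))
            (lmA (mon P c * mon P a * mon P d));
  mA_ge1 : forall a, geA a 0%MM;
  mA_deg : forall a b, (mdeg a < mdeg b)%N -> sgt geA b a
}.

(* The vector lm(p) e_i. *)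
Definition lmAe (p : A) i : option ('X_{1..n} * 'I_m) :=
  omap (fun a => (a, i)) (lmA p).

Record monomial_orderV : Prop := MonomialOrderV {
  mV_total : total_order geV;
  mV_ge : forall a b i, oge geV (lmAe (mon P b * mon P a) i) (Some (a, i));
  mV_mul : forall a b c i j, geV (b, j) (a, i) ->
    oge geV (lmAe (mon P c * mon P b) j) (lmAe (mon P c * mon P a) i);
  mV_deg : forall a b i j, (mdeg a < mdeg b)%N -> sgt geV (b, j) (a, i)
}.

(* On each component of A^m the two orders agree. Conditions on geV alone do
   not imply this: in A = K[x,y] with m = 1, take deglex with x > y for geA and
   deglex with y > x for geV. Dividing x + y by 1 gives q = x + y and h = 0,
   with lm(q) = x for geA but lm(x + y) = y for geV. *)
Definition compatible_orders : Prop :=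
  forall a b i, geA b a -> geV (b, i) (a, i).

(* ------------------------------------------------------------------------ *)

(* The right action of A on A^m. *)
Definition vmul f (p : A) : 'cV[A]_m := \col_i (f i 0 * p).

Definition reduce1 (F : seq 'cV[A]_m) f h : Prop :=
  (f = 0 /\ h = 0) \/
  (f <> 0 /\
   exists (E : 'X_{1..n} * 'I_m) (k : nat) (g : 'I_k -> 'cV[A]_m) (r : 'I_k -> R)
          (a b : 'I_k -> 'X_{1..n}),
     [/\ lmV f = Some E, (0 < k)%N & forall l, g l \in F] /\
     [/\ forall l, lmV (g l) = Some (b l, E.2) /\ (b l + a l)%MM = E.1,
         lcV f = \sum_(l < k) lcV (g l) * sigmaX P (b l) (r l) * cprod P (b l) (a l)
       & h = f - \sum_(l < k) vmul (g l) (emb P (r l) * mon P (a l))]).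

(* A chain of s >= 0 one-step reductions; s = 0 is allowed, since otherwise a
   non-zero reduced vector would not reduce to itself. *)
Definition reduces (F : seq 'cV[A]_m) f h : Prop :=
  exists (s : nat) (w : nat -> 'cV[A]_m),
    [/\ w 0%N = f, w s = h & forall k, (k < s)%N -> reduce1 F (w k) (w k.+1)].

Definition reduced (F : seq 'cV[A]_m) f : Prop :=
  f = 0 \/ ~ exists h, reduce1 F f h.

End MonomialOrders.

(* ------------------------------------------------------------------------ *)

Definition right_ideal (R : pzRingType) (I : R -> Prop) : Prop :=
  [/\ I 0, forall a b, I a -> I b -> I (a + b) & forall a r, I a -> I (a * r)].

Definition right_noetherian (R : pzRingType) : Prop :=
  forall I : R -> Prop, right_ideal I ->
  exists (k : nat) (r : 'rV[R]_k),
    forall a, I a <-> exists b : 'cV[R]_k, (r *m b) 0 0 = a.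

(* The two algorithms are data of the structure: [rgs_mem] solves
   a = r_1 b_1 + ... + r_k b_k, and the columns of [rgs_syz] generate the
   right module of syzygies. *)
Record RGS (R : pzRingType) := MkRGS {
  rgs_noetherian : right_noetherian R;
  rgs_mem : forall k, R -> 'rV[R]_k -> option 'cV[R]_k;
  rgs_memP : forall k (a : R) (r : 'rV[R]_k),
    match rgs_mem a r with
    | Some b => (r *m b) 0 0 = a
    | None => ~ exists b : 'cV[R]_k, (r *m b) 0 0 = a
    end;
  rgs_syz : forall k, 'rV[R]_k -> {l : nat & 'M[R]_(k, l)};
  rgs_syzP : forall k (r : 'rV[R]_k) (b : 'cV[R]_k),
    r *m b = 0 <-> exists c, b = projT2 (rgs_syz r) *m c
}.

(* ------------------------------------------------------------------------ *)

Section Division.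
Context (R A : pzRingType) (n m t : nat) (P : skewPBW R A n).
Context (hP : bijective_ext P) (S : RGS R).
Context (geV : rel ('X_{1..n} * 'I_m)%type) (fs : t.-tuple 'cV[A]_m).

Local Notation lm := (lmV P geV).
Local Notation lc := (lcV P geV).
Local Notation exp := (expV P geV).

Definition lmdvd (g h : 'cV[A]_m) : bool :=
  match lm g, lm h with
  | Some X, Some Y => (X.2 == Y.2) && (X.1 <= Y.1)%MM
  | _, _ => false
  end.

Definition div_state : Type := ({ffun 'I_t -> A} * 'cV[A]_m)%type.

(* One pass through the loop; [None] means that the algorithm stops. *)
Definition div_step (st : div_state) : option div_state :=
  let: (q, h) := st in
  let J := [set j | lmdvd (tnth fs j) h] in
  if (h == 0) || (J == set0) then None else
  let b (j : 'I_t) := exp (tnth fs j) in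
  let a (j : 'I_t) := (exp h - b j)%MM in
  let eqn := \row_(k < #|J|)
    (let j := enum_val k in lc (tnth fs j) * cprod P (b j) (a j)) in
  if rgs_mem S (lc h) eqn is Some s then
    let sJ (j : 'I_t) := \sum_(k < #|J| | enum_val k == j) s k 0 in
    let r (j : 'I_t) := psiV hP (b j) (a j) (sJ j) in
    Some ([ffun j => if j \in J then q j + emb P (r j) * mon P (a j) else q j],
          h - \sum_(j in J) vmul (tnth fs j) (emb P (r j) * mon P (a j)))
  else None.

(* [Some] of the final state if the loop stops within fewer than N passes. *)
Fixpoint div_loop (N : nat) (st : div_state) : option div_state :=
  if N is N'.+1 then
    if div_step st is Some st' then div_loop N' st' else Some st
  else None.

Definition division_output (f : 'cV[A]_m) (q : {ffun 'I_t -> A}) (h : 'cV[A]_m) :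
    Prop :=
  exists N, div_loop N ([ffun=> 0], f) = Some (q, h).

End Division.

(* Main.v *)
Require Import Defs.
From HB Require Import structures.
From mathcomp Require Import all_boot all_order all_algebra.
From mathcomp Require Import finmap monalg mpoly.

Set Implicit Arguments.
Unset Strict Implicit.
Unset Printing Implicit Defensive.

Import GRing.Theory.
Local Open Scope ring_scope.

(** The defining relations of a skew PBW extension only say how two adjacent
    letters are exchanged, and everything about leading terms has to come from
    them.  The convenient filtration is by words: let the elements of length
    less than d be the left R-combinations of words in the x_i with fewer than
    d letters.  It is stable under multiplication by letters and by scalars on
    either side, and modulo shorter words an exchange of neighbouring letters
    multiplies a word by a unit; so a word agrees, up to a unit and shorter
    words, with any rearrangement of it ([similar_perm]), in particular with a
    standard monomial.  Hence the filtration by length is the one by degree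
    ([shorter_deg]), and products of terms obey
      s x^b . r x^a = s sigma^b(r) c_{b,a} x^{b+a} + lower degree
    ([term_mul]) with c_{b,a} invertible ([mon_mul]).  Associativity of
    x^b x^a r' then gives sigma^b(r) c_{b,a} = c_{b,a} psi_{b,a}(r)
    ([cprod_sigma]), which identifies the linear equation solved by the
    algorithm with the one in the definition of reduction.

    Consequently f_j r x^a has leading monomial at most lm(f_j) x^a, and its
    coefficient there is lc(f_j) sigma^b(r) c_{b,a}.  One pass of the loop is
    therefore a one-step reduction, and it cancels the leading term of h, so
    lm(h) strictly decreases ([reduce1_supp]).  A degree-compatible order is a
    well-order, since only finitely many monomials have bounded degree
    ([sgt_wf]); so the loop ends ([div_loop_ends]), and it ends only when h
    admits no further reduction ([div_step_stop]).

    For the leading monomials, every term x^a added to q_j satisfies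
    lm(f_j) x^a = lm(h) for the current h, hence lm(f_j) x^a <= lm(f).  This
    gives one inequality.  If the other failed, every monomial of h and, the
    orders on Mon(A) and Mon(A^m) being compatible, of every f_j q_j would
    differ from lm(f), whereas their sum is f ([lm_division]). *)

Local Notation coord := Defs.coord.
Local Notation coef := Defs.coef.
Local Notation msupp := Defs.msupp.

(** * Coefficients and words in a skew PBW extension *)

Section Coefficients.
Context (R A : pzRingType) (n : nat) (P : skewPBW R A n).
Implicit Types (a b : 'X_{1..n}) (r s : R) (f g p : A).

Definition coefA a f : R := coef a (coord P f).

Lemma coefA_is_additive a : {morph coefA a : f g / f + g}.
Proof. by move=> f g; rewrite /coefA coordD monalg.mcoeffD. Qed.

Lemma coefA0 a : coefA a 0 = 0.
Proof. by apply: (addrI (coefA a 0)); rewrite -coefA_is_additive !addr0. Qed.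

HB.instance Definition _ a :=
  GRing.isNmodMorphism.Build A R (coefA a)
    (conj (coefA0 a) (coefA_is_additive a)).

Lemma mem_coord f a : (a \in msupp (coord P f)) = (coefA a f != 0).
Proof. by rewrite monalg.mcoeff_neq0. Qed.

Lemma coefA_term a b r : coefA a (emb P r * mon P b) = r *+ (b == a).
Proof. by rewrite /coefA coord_mon monalg.mcoeffU. Qed.

Lemma coefA_scale a r f : coefA a (emb P r * f) = r * coefA a f.
Proof.
rewrite (coordK P f) mulr_sumr !raddf_sum mulr_sumr /=.
by apply: eq_bigr => b _; rewrite mulrA -rmorphM !coefA_term mulrnAr.
Qed.

Lemma coefA_inj f g : (forall a, coefA a f = coefA a g) -> f = g.
Proof.
by move=> fg; rewrite (coordK P f) (coordK P g); congr lincomb; apply/malgP.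
Qed.

Lemma sigmaM i : {morph sigma P i : r s / r * s}.
Proof.
move=> r s; have [d E] := sigmaP P i r; have [d' E'] := sigmaP P i s.
apply: (@sigma_unique _ _ _ P _ _ _ (sigma P i r * d' + d * s)).
rewrite !rmorphD !rmorphM mulrA E mulrDl -(mulrA _ _ (emb P s)) E' mulrDr.
by rewrite !mulrA addrA.
Qed.

Lemma sigma1 i : sigma P i 1 = 1.
Proof.
apply: (@sigma_unique _ _ _ P _ _ _ 0).
by rewrite !(rmorph1, rmorph0) mulr1 mul1r addr0.
Qed.

Lemma invertible1 : invertible (1 : R).
Proof. by exists 1; rewrite !mul1r. Qed.

Lemma invertibleM r s : invertible r -> invertible s -> invertible (r * s).
Proof.
move=> [r' [r'r rr']] [s' [s's ss']]; exists (s' * r').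
by split; rewrite -mulrA [X in _ * X]mulrA ?r'r ?ss' mul1r.
Qed.

Lemma sigma_invertible i r : invertible r -> invertible (sigma P i r).
Proof.
by move=> [r' [E F]]; exists (sigma P i r'); rewrite -!sigmaM E F sigma1.
Qed.

Definition word (u : seq 'I_n) : A := \prod_(i <- u) var P i.

Lemma word_cons i u : word (i :: u) = var P i * word u.
Proof. exact: big_cons. Qed.

Lemma word_cat u v : word (u ++ v) = word u * word v.
Proof. exact: big_cat. Qed.

(** The left R-span of the words with fewer than [d] letters.  Unlike the degree,
    which refers to standard monomials, it is visibly compatible with products;
    that the two filtrations agree is [shorter_deg]. *)
Inductive shorter (d : nat) : A -> Prop :=
| shorter0 : shorter d 0
| shorterD f g : shorter d f -> shorter d g -> shorter d (f + g)
| shorter_word r u : (size u < d)%N -> shorter d (emb P r * word u).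

Lemma shorter_le d e f : (d <= e)%N -> shorter d f -> shorter e f.
Proof.
move=> le_de; elim=> [|g h _ Hg _ Hh|r u du]; first exact: shorter0.
  exact: shorterD.
by apply: shorter_word; apply: leq_trans le_de.
Qed.

Lemma shorter_scale d r f : shorter d f -> shorter d (emb P r * f).
Proof.
elim=> [|g h _ Hg _ Hh|s u du]; first by rewrite mulr0; apply: shorter0.
  by rewrite mulrDr; apply: shorterD.
by rewrite mulrA -rmorphM; apply: shorter_word.
Qed.

Lemma shorter_lword d u f :
  shorter d f -> shorter (size u + d) (word u * f).
Proof.
elim: u => [|i u IH] in d f *; first by rewrite /word big_nil mul1r.
move/IH; rewrite word_cons -mulrA /= addSn; move: (size u + d)%N (word u * f).
move=> {IH}e g; elim=> [|h h' _ Hh _ Hh'|r v ve].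
- by rewrite mulr0; apply: shorter0.
- by rewrite mulrDr; apply: shorterD.
have [d' E] := sigmaP P i r; rewrite mulrA E mulrDl -mulrA -word_cons.
by apply: shorterD; apply: shorter_word; rewrite // ltnW.
Qed.

Lemma shorter_rword d f u :
  shorter d f -> shorter (d + size u) (f * word u).
Proof.
elim=> [|g h _ Hg _ Hh|r v vd]; first by rewrite mul0r; apply: shorter0.
  by rewrite mulrDl; apply: shorterD.
by rewrite -mulrA -word_cat; apply: shorter_word; rewrite size_cat ltn_add2r.
Qed.

(** A scalar moves to the left through a word one letter at a time; each
    derivation term drops the letter that it passes. *)
Lemma word_emb u r : exists2 p,
  word u * emb P r = emb P (foldr (sigma P) r u) * word u + p
  & shorter (size u) p.
Proof.
elim: u => [|i u [p E Hp]] /=.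
  by exists 0; [rewrite /word big_nil mul1r mulr1 addr0 | apply: shorter0].
have [d F] := sigmaP P i (foldr (sigma P) r u).
exists (emb P d * word u + var P i * p).
  by rewrite word_cons -mulrA E mulrDr mulrA F mulrDl -!mulrA !addrA.
apply: shorterD; first exact: shorter_word.
by have := shorter_lword [:: i] Hp; rewrite /word big_seq1.
Qed.

Lemma shorter_remb d f r : shorter d f -> shorter d (f * emb P r).
Proof.
elim=> [|g h _ Hg _ Hh|s v vd]; first by rewrite mul0r; apply: shorter0.
  by rewrite mulrDl; apply: shorterD.
have [p E Hp] := word_emb v r; rewrite -mulrA E mulrDr mulrA -rmorphM.
apply: shorterD; first exact: shorter_word.
by apply: shorter_scale; apply: shorter_le Hp; apply: ltnW.
Qed.

Definition exponents (u : seq 'I_n) : 'X_{1..n} := [multinom count_mem i u | i < n].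

Definition sorted_word a : seq 'I_n := flatten [seq nseq (a i) i | i <- enum 'I_n].

Lemma mon_word a : mon P a = word (sorted_word a).
Proof.
rewrite /mon /monomial /word /sorted_word big_flatten big_map /=.
rewrite enumT [index_enum _]unlock.
by apply: eq_bigr => i _; rewrite big_nseq -Monoid.iteropE.
Qed.

Lemma sorted_word_sigma a r :
  foldr (sigma P) r (sorted_word a) = sigmaX P a r.
Proof.
rewrite /sigmaX /sorted_word; elim: (enum _) => //= i s <-.
by rewrite foldr_cat; elim: (a i) => //= k ->.
Qed.

Lemma count_sorted_word a i : count_mem i (sorted_word a) = a i.
Proof.
rewrite /sorted_word count_flatten sumnE -map_comp big_map.
rewrite big_enum /= (bigD1 i) //= count_nseq /= eqxx mul1n.
by rewrite big1 ?addn0 // => j /negbTE ji; rewrite count_nseq /= ji.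
Qed.

Lemma size_sorted_word a : size (sorted_word a) = mdeg a.
Proof.
rewrite /sorted_word size_flatten /shape -map_comp sumnE big_map mdegE.
by rewrite big_enum /=; apply: eq_bigr => i _; rewrite size_nseq.
Qed.

Lemma sorted_word_perm u a :
  (forall i, count_mem i u = a i) -> perm_eq u (sorted_word a).
Proof. by move=> E; apply/allP => i _ /=; rewrite count_sorted_word E. Qed.

End Coefficients.

(** * Products of terms *)

Section Bijective.
Context (R A : pzRingType) (n : nat) (P : skewPBW R A n) (hP : bijective_ext P).
Implicit Types (a b : 'X_{1..n}) (r s : R) (f g p : A).

(** Equality up to a left unit and modulo shorter words. *)
Definition similar (u v : seq 'I_n) : Prop :=
  exists c p, [/\ invertible c, shorter P (size u) p
                & word P u = emb P c * word P v + p].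

Lemma similar_refl u : similar u u.
Proof.
exists 1, 0; split; [exact: invertible1 | exact: shorter0 |].
by rewrite rmorph1 mul1r addr0.
Qed.

Lemma similar_trans u v w :
  size u = size v -> similar u v -> similar v w -> similar u w.
Proof.
move=> uv [c [p [Hc Hp E]]] [d [q [Hd Hq F]]].
exists (c * d), (emb P c * q + p); split; first exact: invertibleM.
  by apply: shorterD => //; rewrite uv; apply: shorter_scale.
by rewrite E F mulrDr mulrA -rmorphM addrA.
Qed.

Lemma similar_cons i u v :
  size u = size v -> similar u v -> similar (i :: u) (i :: v).
Proof.
move=> uv [c [p [Hc Hp E]]]; have [d F] := sigmaP P i c.
exists (sigma P i c), (emb P d * word P v + var P i * p); split.
- exact: sigma_invertible.
- apply: shorterD; first by apply: shorter_word; rewrite /= uv.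
  by have := shorter_lword [:: i] Hp; rewrite /word big_seq1.
by rewrite !word_cons E mulrDr mulrA F mulrDl -!mulrA addrA.
Qed.

Lemma similar_swap i j u : similar (i :: j :: u) (j :: i :: u).
Proof.
have [d [e E]] := var_var P j i.
exists (cst P j i), ((emb P d + \sum_(k < n) emb P (e k) * var P k) * word P u).
split; first exact: hP.2.
  rewrite mulrDl mulr_suml; apply: shorterD; first by apply: shorter_word => /=.
  elim/big_ind: _ => [||k _]; [exact: shorter0 | exact: shorterD |].
  by rewrite -mulrA -word_cons; apply: shorter_word.
by rewrite !word_cons -E !mulrA -mulrDl addrC subrK.
Qed.

(** Exchanges of neighbours generate all rearrangements: the first letter of [v]
    is brought to the front of [u], and the tails are compared by induction. *)
Lemma similar_perm u v : perm_eq u v -> similar u v.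
Proof.
elim: v u => [|i v IH] u uv.
  by rewrite (nilP (_ : nilp u)) /nilp ?(perm_size uv) //; apply: similar_refl.
have /splitPr uE : i \in u by rewrite (perm_mem uv) mem_head.
case: uE uv => u1 u2; rewrite perm_catC cat_cons perm_cons perm_catC => uv.
have su : size (u1 ++ i :: u2) = (size (u1 ++ u2)).+1.
  by rewrite !size_cat /= addnS.
apply: (@similar_trans _ (i :: u1 ++ u2)) => //; last first.
  by apply: similar_cons (IH _ uv); apply: perm_size.
elim: u1 {uv su} => [|j u1 IHu] /=; first exact: similar_refl.
apply: (@similar_trans _ (j :: i :: u1 ++ u2)) (similar_swap _ _ _).
  by rewrite /= !size_cat /= addnS.
by apply: similar_cons IHu; rewrite /= !size_cat /= addnS.
Qed.

(** A word is a unit times a standard monomial of degree its length, up to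
    shorter words, to which induction on the length applies. *)
Lemma shorter_deg d f :
  shorter P d f -> forall a, coefA P a f != 0 -> (mdeg a < d)%N.
Proof.
elim/ltn_ind: d f => d IH f; elim=> [|g h _ Hg _ Hh|r u ud] a.
- by rewrite raddf0 eqxx.
- rewrite raddfD /=; have [->|g0 _] := eqVneq (coefA P a g) 0; last exact: Hg.
  by rewrite add0r; apply: Hh.
have [c [p [_ Hp E]]] := similar_perm (sorted_word_perm (a := exponents u)
  (fun i => esym (mnmE _ i))).
rewrite coefA_scale E -mon_word raddfD /= coefA_term.
have [<- _|_] := eqVneq (exponents u) a; last first.
  rewrite add0r => pa; apply: ltn_trans (IH _ ud _ Hp a _) ud.
  by apply: contraNneq pa => ->; rewrite mulr0.
suff -> : mdeg (exponents u) = size u by [].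
rewrite -size_sorted_word; apply/esym/perm_size/sorted_word_perm => i.
by rewrite mnmE.
Qed.

Lemma shorter_coef0 d a f : shorter P d f -> (d <= mdeg a)%N -> coefA P a f = 0.
Proof.
move=> Hf da; apply/eqP; apply: contraT => /(shorter_deg Hf).
by rewrite ltnNge da.
Qed.

(** The concatenation of the sorted words of [a] and [b] rearranges the
    sorted word of [a + b]; the unit of the rearrangement is c_{a,b}. *)
Lemma mon_mul a b : exists p, [/\ invertible (cprod P a b),
  shorter P (mdeg (a + b)) p
  & mon P a * mon P b = emb P (cprod P a b) * mon P (a + b) + p].
Proof.
have [i|c [p [Hc Hp E]]] := similar_perm
  (@sorted_word_perm _ (sorted_word a ++ sorted_word b) (a + b)%MM _).
  by rewrite count_cat !count_sorted_word mnmDE.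
rewrite size_cat !size_sorted_word -mdegD in Hp.
suff -> : cprod P a b = c by exists p; split; rewrite // !mon_word -word_cat.
rewrite /cprod !mon_word -word_cat E -!mon_word.
by rewrite -/(coefA _ _ _) raddfD /= coefA_term eqxx (shorter_coef0 Hp) ?addr0.
Qed.

Lemma mon_emb a r : exists2 p,
  mon P a * emb P r = emb P (sigmaX P a r) * mon P a + p & shorter P (mdeg a) p.
Proof.
have [p E Hp] := word_emb P (sorted_word a) r; exists p.
  by rewrite !mon_word E sorted_word_sigma.
by rewrite -size_sorted_word.
Qed.

Lemma term_mul b a s r : exists2 p,
  (emb P s * mon P b) * (emb P r * mon P a)
    = emb P (s * sigmaX P b r * cprod P b a) * mon P (b + a) + p
  & shorter P (mdeg (b + a)) p.
Proof.
have [p E Hp] := mon_emb b r; have [q [_ Hq F]] := mon_mul b a.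
exists (emb P (s * sigmaX P b r) * q + emb P s * (p * mon P a)).
  rewrite mulrA -(mulrA _ (mon P b)) E mulrDr mulrDl -!mulrA F.
  by rewrite !rmorphM !mulrDr !mulrA !addrA.
apply: shorterD; first exact: shorter_scale.
apply: shorter_scale; rewrite mdegD -(size_sorted_word a) mon_word.
exact: shorter_rword.
Qed.

(** Both sides are the coefficient of x^{b+a} in x^b x^a r', where
    sigma^a(r') = r, computed with the two bracketings. *)
Lemma cprod_sigma b a r :
  sigmaX P b r * cprod P b a = cprod P b a * psi hP b a r.
Proof.
rewrite /psi; set r' := sigmaXV hP a r.
have <- : sigmaX P a r' = r by apply: bij_invKV.
have [p [_ Hp E]] := mon_mul b a; have [q F Hq] := mon_emb a r'.
have [p' E' Hp'] := mon_emb (b + a) r'.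
have [q' F' Hq'] := term_mul b a 1 (sigmaX P a r').
rewrite rmorph1 !mul1r in F'.
have := congr1 (coefA P (b + a)%MM) (mulrA (mon P b) (mon P a) (emb P r')).
rewrite F mulrDr F' E mulrDl -(mulrA (emb P (cprod P b a))) E' mulrDr mulrA -rmorphM.
rewrite !raddfD /= !coefA_term eqxx coefA_scale !mulr1n.
rewrite (shorter_coef0 Hq') // (shorter_coef0 Hp') //.
rewrite (shorter_coef0 (shorter_remb _ Hp)) //.
rewrite (@shorter_coef0 (mdeg (b + a))) ?mulr0 ?addr0 //.
by rewrite mdegD -(size_sorted_word b) mon_word; apply: shorter_lword.
Qed.

End Bijective.

(** * Maxima in an order with a least element adjoined *)

Section OptionOrder.
Context (T : eqType) (ge : rel T) (hge : total_order ge).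

Lemma oge_refl : reflexive (oge ge).
Proof. by have [r _ _ _] := hge; case=> /=. Qed.

Lemma oge_trans : transitive (oge ge).
Proof. by have [_ _ t _] := hge; case=> [y|] [x|] [z|] //=; apply: t. Qed.

Lemma oge_anti u v : oge ge u v -> oge ge v u -> u = v.
Proof.
have [_ a _ _] := hge; case: u v => [x|] [y|] //= xy yx.
by congr Some; apply: a; rewrite xy.
Qed.

Lemma omax_eq u v : omax ge u v = u \/ omax ge u v = v.
Proof. by rewrite /omax; case: ifP; [left | right]. Qed.

Lemma oge_omax w u v : oge ge (omax ge u v) w = oge ge u w || oge ge v w.
Proof.
have [_ _ _ tot] := hge; rewrite /omax; case: ifPn => uv.
  by apply/esym/orb_idr => vw; apply: oge_trans vw.
apply/esym/orb_idl; apply: oge_trans.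
by case: u v uv => [x|] [y|] //=; have /orP[] := tot x y => ->.
Qed.

Lemma oge_bigomax (I : eqType) (s : seq I) (F : I -> option T) w :
  (exists2 i, i \in s & oge ge (F i) w) ->
  oge ge (\big[omax ge/None]_(i <- s) F i) w.
Proof.
elim: s => [[]|j s IH [i]] //; rewrite inE big_cons oge_omax.
by case/orP=> [/eqP->->//|is' Fi]; rewrite IH ?orbT //; exists i.
Qed.

Lemma bigomax_Some (I : eqType) (s : seq I) (F : I -> option T) x :
  \big[omax ge/None]_(i <- s) F i = Some x -> exists2 i, i \in s & F i = Some x.
Proof.
elim: s => [|j s IH]; first by rewrite big_nil.
rewrite big_cons; case: (omax_eq (F j) (\big[omax ge/None]_(i <- s) F i)) => ->.
  by exists j; rewrite ?mem_head.
by case/IH => i is' Fi; exists i; rewrite ?inE ?is' ?orbT.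
Qed.

End OptionOrder.

(** * Leading monomials of vectors *)

Section Vectors.
Context (R A : pzRingType) (n m : nat) (P : skewPBW R A n) (hP : bijective_ext P).
Context (geA : rel 'X_{1..n}) (geV : rel ('X_{1..n} * 'I_m)%type).
Context (hA : monomial_orderA P geA) (hV : monomial_orderV P geA geV).
Implicit Types (a b c e : 'X_{1..n}) (i j : 'I_m) (r s : R) (p : A).
Implicit Types (f g h : 'cV[A]_m) (X Y E : ('X_{1..n} * 'I_m)%type).
Implicit Types (B : pred ('X_{1..n} * 'I_m)%type).

Let totA := mA_total hA.
Let totV := mV_total hV.

Definition coefV X f : R := coefA P X.1 (f X.2 0).

Lemma coefV_is_additive X : {morph coefV X : f g / f + g}.
Proof. by move=> f g; rewrite /coefV mxE raddfD. Qed.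

Lemma coefV0 X : coefV X 0 = 0.
Proof. by rewrite /coefV mxE raddf0. Qed.

HB.instance Definition _ X :=
  GRing.isNmodMorphism.Build 'cV[A]_m R (coefV X)
    (conj (coefV0 X) (coefV_is_additive X)).

Lemma coefV_eq0 f : (forall X, coefV X f = 0) -> f = 0.
Proof.
move=> f0; apply/colP => i; apply: (@coefA_inj _ _ _ P) => a.
by rewrite mxE raddf0; apply: (f0 (a, i)).
Qed.

Lemma lmA_ub p a : coefA P a p != 0 -> oge geA (lmA P geA p) (Some a).
Proof.
rewrite -mem_coord => pa; apply: (oge_bigomax totA); exists a => //.
exact: oge_refl.
Qed.

Lemma lmA_coef p a : lmA P geA p = Some a -> coefA P a p != 0.
Proof. by case/bigomax_Some => b pb [<-]; rewrite -mem_coord. Qed.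

Lemma lmA_eq p a : coefA P a p != 0 ->
  (forall b, coefA P b p != 0 -> geA a b) -> lmA P geA p = Some a.
Proof.
move=> pa p_le; apply: (oge_anti totA); first exact: lmA_ub.
by case E: lmA => [b|] //=; apply/p_le/lmA_coef.
Qed.

Lemma lmA_None p : lmA P geA p = None -> p = 0.
Proof.
move=> p0; apply: (@coefA_inj _ _ _ P) => a; rewrite raddf0.
by apply/eqP; apply: contraT => /lmA_ub; rewrite p0.
Qed.

Lemma lmV_ub f X : coefV X f != 0 -> oge geV (lmV P geV f) (Some X).
Proof.
case: X => a i; rewrite /coefV -mem_coord /= => fa.
apply: (oge_bigomax totV); exists i; first exact: mem_index_enum.
by apply: (oge_bigomax totV); exists a => //; apply: oge_refl.
Qed.

Lemma lmV_coef f X : lmV P geV f = Some X -> coefV X f != 0.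
Proof.
case/bigomax_Some => i _ /bigomax_Some[a fa [<-]].
by rewrite /coefV -mem_coord.
Qed.

Lemma lmV_eq f X : coefV X f != 0 ->
  (forall Y, coefV Y f != 0 -> geV X Y) -> lmV P geV f = Some X.
Proof.
move=> fX f_le; apply: (oge_anti totV); first exact: lmV_ub.
by case E: lmV => [b|] //=; apply/f_le/lmV_coef.
Qed.

Lemma lmV_None f : lmV P geV f = None <-> f = 0.
Proof.
split=> [f0|->].
  by apply: coefV_eq0 => X; apply/eqP; apply: contraT => /lmV_ub; rewrite f0.
by case E: lmV => [X|] //; have := lmV_coef E; rewrite raddf0 eqxx.
Qed.

Lemma lcV_coef f X : lmV P geV f = Some X -> lcV P geV f = coefV X f.
Proof. by rewrite /lcV => ->. Qed.

(** With [B] the monomials below a given one, weakly or strictly, this bounds the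
    leading monomial while remaining closed under sums. *)
Definition supported B f : Prop := forall X, coefV X f != 0 -> B X.

Lemma supportedB B f g : supported B f -> supported B g -> supported B (f - g).
Proof.
move=> Bf Bg X; rewrite raddfB /=; have [->|/Bf//] := eqVneq (coefV X f) 0.
by rewrite sub0r oppr_eq0 => /Bg.
Qed.

Lemma supported_sum B (I : Type) (s : seq I) (Q : pred I) (F : I -> 'cV[A]_m) :
  (forall k, Q k -> supported B (F k)) -> supported B (\sum_(k <- s | Q k) F k).
Proof.
move=> BF; elim/big_ind: _ => // [X|f g Bf Bg X]; first by rewrite raddf0 eqxx.
rewrite raddfD /=; have [->|/Bf//] := eqVneq (coefV X f) 0.
by rewrite add0r => /Bg.
Qed.

Lemma supported_lmV f X : lmV P geV f = Some X -> supported (geV X) f.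
Proof. by move=> E Y /lmV_ub; rewrite E. Qed.

Lemma coefA_mul_term p r a e :
  coefA P e (p * (emb P r * mon P a)) =
  \sum_(c <- msupp (coord P p))
     coefA P e (emb P (coefA P c p) * mon P c * (emb P r * mon P a)).
Proof. by rewrite {1}(coordK P p) mulr_suml raddf_sum. Qed.

(** In degree at least that of the product of the two monomials, the lower terms
    of the product of two terms are invisible. *)
Lemma coefA_term_mul s c r a e :
  (mdeg (c + a) <= mdeg e)%N ->
  coefA P e (emb P s * mon P c * (emb P r * mon P a)) =
  (s * sigmaX P c r * cprod P c a) *+ (c + a == e)%MM.
Proof.
have [q -> Hq] := term_mul hP c a s r => le_e.
by rewrite raddfD /= coefA_term (shorter_coef0 hP Hq) // addr0.
Qed.

Lemma mul_term_supp p r a e : coefA P e (p * (emb P r * mon P a)) != 0 ->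
  exists2 c, coefA P c p != 0 & e = (c + a)%MM \/ (mdeg e < mdeg (c + a))%N.
Proof.
rewrite coefA_mul_term => nz.
have /hasP[c pc cP] : has (fun c => ((c + a)%MM == e) || (mdeg e < mdeg (c + a))%N)
    (msupp (coord P p)).
  apply: contraNT nz => /hasPn none; rewrite big_seq big1 // => c /none.
  rewrite negb_or -leqNgt => /andP[/negbTE ne le].
  by rewrite coefA_term_mul // ne.
exists c; first by rewrite -mem_coord.
by case/orP: cP => [/eqP->|]; [left | right].
Qed.

(** Among the monomials x^c of [p], only x^b contributes to x^{b+a}: the lower
    terms that the products create have degree below that of [c + a], which is at
    most that of [b + a]. *)
Lemma mul_term_lead p r a b :
  (forall c, coefA P c p != 0 -> (mdeg c <= mdeg b)%N) ->
  coefA P (b + a)%MM (p * (emb P r * mon P a)) =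
  coefA P b p * sigmaX P b r * cprod P b a.
Proof.
move=> p_le; rewrite coefA_mul_term big_seq.
under eq_bigr => c cp do
  rewrite coefA_term_mul ?eqm_add2r ?mdegD ?leq_add2r ?p_le -?mem_coord //.
rewrite -big_seq; have [pb|] := boolP (b \in msupp (coord P p)).
  rewrite (bigD1_seq b) ?fset_uniq //= eqxx big1 ?addr0 // => c /negbTE->.
  exact: mulr0n.
rewrite mem_coord negbK => /eqP p0; rewrite p0 !mul0r big_seq big1 // => c pc.
by case: eqP pc => [->|//]; rewrite mem_coord p0 eqxx.
Qed.

Lemma geV_deg a b i j : geV (b, j) (a, i) -> (mdeg a <= mdeg b)%N.
Proof.
move=> ba; rewrite leqNgt; apply/negP => /(mV_deg hV j i)/andP[ab].
have [_ anti _ _] := totV; have -> : (a, i) = (b, j) by apply: anti; rewrite ab ba.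
by rewrite eqxx.
Qed.

(* In the zero ring the units c_{a,b} vanish, and a product of monomials has no
   leading monomial. *)
Section Nontrivial.
Hypothesis R_neq0 : (1 : R) != 0.

Lemma invertible_neq0 r : invertible r -> r != 0.
Proof.
by case=> r' [_ rr']; apply: contraNneq R_neq0 => r0; rewrite -rr' r0 mul0r.
Qed.

Lemma mon_mul_supp a b c : coefA P c (mon P a * mon P b) != 0 ->
  c = (a + b)%MM \/ (mdeg c < mdeg (a + b))%N.
Proof.
have [p [_ Hp ->]] := mon_mul hP a b; rewrite raddfD /= coefA_term.
have [<-|_] := eqVneq (a + b)%MM c; first by left.
by rewrite add0r => /(shorter_deg hP Hp); right.
Qed.

Lemma cprod_neq0 a b : cprod P a b != 0.
Proof. by have [p [/invertible_neq0]] := mon_mul hP a b. Qed.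

Lemma lmA_mon_mul a b : lmA P geA (mon P a * mon P b) = Some (a + b)%MM.
Proof.
apply: lmA_eq => [|c /mon_mul_supp[->|lt]]; first exact: cprod_neq0.
  by have [r _ _ _] := totA; apply: r.
by have /andP[] := mA_deg hA lt.
Qed.

(** The order axiom speaks of lm(x^c x^b), which is x^{c+b} because c_{c,b} is a
    unit. *)
Lemma geV_mul a b c i j :
  geV (b, j) (a, i) -> geV ((b + c)%MM, j) ((a + c)%MM, i).
Proof.
by move/(mV_mul hV c); rewrite /lmAe !lmA_mon_mul /= ![(c + _)%MM]addmC.
Qed.

Lemma geV_deg_add a b c e i j : geV (b, j) (a, i) ->
  e = (a + c)%MM \/ (mdeg e < mdeg (a + c))%N -> geV ((b + c)%MM, j) (e, i).
Proof.
move=> /(geV_mul c) ge_ba [->//|lt].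
have [_ _ t _] := totV; apply: t ge_ba _.
by have /andP[] := mV_deg hV i i lt.
Qed.

Lemma supported_vmul_term g b i r a : lmV P geV g = Some (b, i) ->
  supported (geV ((b + a)%MM, i)) (vmul g (emb P r * mon P a)).
Proof.
move=> lmg [e k]; rewrite /coefV mxE /= => /mul_term_supp[c gc].
apply: geV_deg_add; exact: (@supported_lmV _ _ lmg (c, k) gc).
Qed.

(** Compatibility ensures that the terms of [p] below lm(p) for the order on
    Mon(A) give products below lm(g) lm(p) for the order on Mon(A^m). *)
Lemma supported_vmul g b i p a : compatible_orders geA geV ->
  lmV P geV g = Some (b, i) -> lmA P geA p = Some a ->
  supported (geV ((b + a)%MM, i)) (vmul g p).
Proof.
move=> compat lmg lmp; rewrite (coordK P p).
have -> (s : seq 'X_{1..n}) (F : 'X_{1..n} -> A) :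
    vmul g (\sum_(c <- s) F c) = \sum_(c <- s) vmul g (F c).
  apply/colP => k; rewrite mxE summxE mulr_sumr.
  by apply: eq_bigr => c _; rewrite mxE.
rewrite big_seq; apply: supported_sum => c.
rewrite mem_coord => /lmA_ub; rewrite lmp /= => /compat - /(_ i) /(geV_mul b).
rewrite ![(_ + b)%MM]addmC => ac X /(supported_vmul_term lmg).
by have [_ _ t _] := totV; apply: t ac.
Qed.

Lemma lmV_vmul_mon b i a :
  lmV P geV (vmul (valV P (Some (b, i))) (valA P (Some a))) = Some ((b + a)%MM, i).
Proof.
have E (X : 'X_{1..n} * 'I_m) :
    coefV X (vmul (valV P (Some (b, i))) (valA P (Some a))) =
     coefA P X.1 (mon P b * mon P a) *+ (X.2 == i).
  rewrite /coefV !mxE /= andbT; case: (X.2 == i); first by rewrite mulr1.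
  by rewrite mulr0 mul0r raddf0.
apply: lmV_eq => [|[e k]]; rewrite E /=; first by rewrite eqxx; apply: cprod_neq0.
have [->|_] := eqVneq k i; last by rewrite eqxx.
move/mon_mul_supp; apply: geV_deg_add.
by have [r _ _ _] := totV; apply: r.
Qed.

End Nontrivial.

Lemma coefV_vmul_term g b i r a : lmV P geV g = Some (b, i) ->
  coefV ((b + a)%MM, i) (vmul g (emb P r * mon P a)) =
  lcV P geV g * sigmaX P b r * cprod P b a.
Proof.
move=> lmg; rewrite (lcV_coef lmg) /coefV mxE /=; apply: mul_term_lead => c gc.
by apply: geV_deg (@supported_lmV _ _ lmg (c, i) gc).
Qed.

Lemma lmV_nontrivial f X : lmV P geV f = Some X -> (1 : R) != 0.
Proof.
by move/lmV_coef; apply: contraNneq => R0; rewrite -[coefV _ _]mul1r R0 mul0r.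
Qed.

(** The condition on leading coefficients says that the coefficients at lm(f)
    cancel, and no subtracted multiple has a monomial above lm(f). *)
Lemma reduce1_supp (F : seq 'cV[A]_m) f h E : lmV P geV f = Some E ->
  reduce1 P geV F f h -> supported (sgt geV E) h.
Proof.
move=> lmf [[f0 _]|[_ [E' [k [g [r [a [b [[lmf' _ _] [lmg lcf ->]]]]]]]]]].
  by move/lmV_None: f0; rewrite lmf.
have EE : E' = E by move: lmf'; rewrite lmf => -[].
rewrite {E' lmf'}EE in lmg.
have nz := lmV_nontrivial lmf.
have coefE : coefV E (f - \sum_(l < k) vmul (g l) (emb P (r l) * mon P (a l))) = 0.
  rewrite raddfB raddf_sum /= -(lcV_coef lmf) lcf; apply/eqP; rewrite subr_eq0.
  apply/eqP/eq_bigr => l _; have [lmgl E_l] := lmg l.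
  by rewrite -(coefV_vmul_term _ _ lmgl) E_l -surjective_pairing.
move=> X hX; rewrite /sgt andbC; apply/andP; split.
  by apply: contraNneq hX => <-; rewrite coefE.
move: X hX; apply: supportedB; first exact: supported_lmV.
apply: supported_sum => l _; have [lmgl E_l] := lmg l.
by rewrite [E]surjective_pairing -E_l; apply: supported_vmul_term.
Qed.

(** Going down never raises the degree, so a descent from [X] stays in the finite
    set of monomials of degree at most that of [X]. *)
Lemma sgt_wf : well_founded (fun Y X => sgt geV X Y).
Proof.
have [_ anti trans _] := totV.
have sgt_trans X Y Z : sgt geV X Y -> sgt geV Y Z -> sgt geV X Z.
  move=> /andP[XY nXY] /andP[YZ nYZ]; rewrite /sgt (trans _ _ _ XY YZ) /=.
  by apply: contraNneq nXY => XZ; apply/eqP/anti; rewrite XY XZ.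
move=> X0; have [D X0D] := ubnP (mdeg X0.1).
pose below X := [set Y : 'X_{1..n < D} * 'I_m | sgt geV X (val Y.1, Y.2)].
(* The number of monomials strictly below decreases along a descent, because
   the new monomial itself leaves the set. *)
have [N] := ubnP #|below X0|.
elim: N X0 X0D => [|N IH] X XD lt_N; first by rewrite ltn0 in lt_N.
constructor=> Y XY.
have YD : (mdeg Y.1 < D)%N.
  apply: leq_ltn_trans XD; case: X Y XY {lt_N} => [a i] [b j] /andP[XY _].
  exact: geV_deg XY.
apply: IH => //; apply: leq_trans (lt_N : #|below X| <= N)%N; apply: proper_card.
apply/properP; split.
  by apply/subsetP => Z; rewrite !inE; apply: sgt_trans.
exists (BMultinom YD, Y.2); rewrite !inE /= -surjective_pairing //.
by rewrite /sgt eqxx andbF.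
Qed.
End Vectors.

(** * The division algorithm *)

Section DivisionAlgorithm.
Context (R A : pzRingType) (n m t : nat) (P : skewPBW R A n).
Context (hP : bijective_ext P) (S : RGS R).
Context (geA : rel 'X_{1..n}) (geV : rel ('X_{1..n} * 'I_m)%type).
Context (hA : monomial_orderA P geA) (hV : monomial_orderV P geA geV).
Context (fs : t.-tuple 'cV[A]_m).
Implicit Types (q : {ffun 'I_t -> A}) (f h : 'cV[A]_m) (j : 'I_t).

Local Notation lm := (lmV P geV).
Local Notation lc := (lcV P geV).
Local Notation step := (div_step hP S geV fs).

Lemma psiVK a b r : psi hP a b (psiV hP a b r) = r.
Proof. exact: bij_invKV. Qed.

Lemma vmulD f p p' : vmul f (p + p') = vmul f p + vmul f p'.
Proof. by apply/colP => i; rewrite !mxE mulrDr. Qed.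

Lemma vmul0 f : vmul f 0 = 0 :> 'cV[A]_m.
Proof. by apply/colP => i; rewrite !mxE mulr0. Qed.

Lemma lmdvdP f h E : lm h = Some E -> lmdvd P geV f h ->
  lm f = Some (expV P geV f, E.2) /\ (expV P geV f + (E.1 - expV P geV f))%MM = E.1.
Proof.
move=> lmh; rewrite /lmdvd /expV lmh; case: (lm f) => // -[b i] /= /andP[/eqP-> bE].
by rewrite addmC submK.
Qed.

(** What one pass of the loop guarantees, with [E] = lm(h): the terms that enter
    the quotients have exponents [a] with lm(f_j) x^a = lm(h). *)
Variant step_spec q h : {ffun 'I_t -> A} * 'cV[A]_m -> Prop :=
  StepSpec E (q' : {ffun 'I_t -> A}) h' of lm h = Some E & reduce1 P geV fs h h'
  & (forall j a, coefA P a (q' j) != 0 -> coefA P a (q j) != 0 \/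
      exists b, lm (tnth fs j) = Some (b, E.2) /\ (b + a)%MM = E.1)
  & \sum_(j < t) vmul (tnth fs j) (q' j) + h' =
    \sum_(j < t) vmul (tnth fs j) (q j) + h
  : step_spec q h (q', h').

Lemma div_step_spec q h st : step (q, h) = Some st -> step_spec q h st.
Proof.
rewrite /div_step; set J := [set j | _]; case: ifP => // /negbT.
rewrite negb_or => /andP[h0 J0].
case lmh: (lm h) => [E|]; last by move/(lmV_None hV): lmh h0 => ->; rewrite eqxx.
have expE : expV P geV h = E.1 by rewrite /expV lmh.
set eqn := \row_k _; have := rgs_memP S (lc h) eqn.
case: rgs_mem => // s; rewrite mxE => lch /=; rewrite expE => -[<-].
pose r j := psiV hP (expV P geV (tnth fs j)) (E.1 - expV P geV (tnth fs j))%MM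
  (\sum_(k < #|J| | enum_val k == j) s k 0).
have dvdJ j : j \in J -> lm (tnth fs j) = Some (expV P geV (tnth fs j), E.2) /\
    (expV P geV (tnth fs j) + (E.1 - expV P geV (tnth fs j)))%MM = E.1.
  by rewrite inE; apply: lmdvdP.
apply: (@StepSpec q h E) => //.
- right; split; first exact/eqP.
  exists E, #|J|, (fun k => tnth fs (enum_val k)), (fun k => r (enum_val k)),
    (fun k => E.1 - expV P geV (tnth fs (enum_val k)))%MM,
    (fun k => expV P geV (tnth fs (enum_val k))).
  split; first by split; rewrite ?card_gt0 // => k; apply: mem_tnth.
  split=> [k||]; first exact: dvdJ (enum_valP k).
    rewrite -lch; apply: eq_bigr => k _; rewrite mxE expE -!mulrA; congr (_ * _).
    rewrite /r cprod_sigma psiVK; congr (_ * _).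
    by rewrite (big_pred1 k) // => k'; rewrite (inj_eq enum_val_inj).
  by rewrite big_enum_val.
- move=> j a; rewrite ffunE; case: ifP => [/dvdJ[lmj Ej]|_]; last by left.
  rewrite raddfD /= coefA_term.
  have [<- _|_] := eqVneq (E.1 - expV P geV (tnth fs j))%MM a.
    by right; exists (expV P geV (tnth fs j)).
  by rewrite addr0; left.
rewrite addrCA [in RHS]addrC; congr (h + _).
apply/eqP; rewrite subr_eq [X in _ == _ + X]big_mkcond -big_split /=.
apply/eqP/eq_bigr => j _; rewrite ffunE; case: ifP => _; last by rewrite addr0.
exact: vmulD.
Qed.

(** A reduction of [h] may use some f_j several times.  Adding up the psi(r_l) of
    the repetitions of each f_j gives a solution of the equation that the
    algorithm found insoluble. *)
Lemma div_step_stop q h : step (q, h) = None -> reduced P geV fs h.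
Proof.
rewrite /div_step; set J := [set j | _].
case: (eqVneq h 0) => [->|h0] /=; first by left.
set eqn := \row_k _; move=> stop; right.
move=> [h' [[/eqP]|[_ [E [k [g [r [a [b [[lmh k0 gF] [lmg lch _]]]]]]]]]]].
  by rewrite (negbTE h0).
(* [ix l] is the position in the list of the divisor used in summand [l]. *)
have /fin_all_exists[ix gE] l : exists j, g l = tnth fs j by apply/tnthP/gF.
have expE : expV P geV h = E.1 by rewrite /expV lmh.
have expg l : expV P geV (g l) = b l by rewrite /expV (lmg l).1.
have ixJ l : ix l \in J.
  have [lmgl bE] := lmg l.
  by rewrite inE /lmdvd -gE lmgl lmh eqxx /= -bE lem_addr.
have JN0 : (J == set0) = false.
  by apply/negbTE/set0Pn; exists (ix (Ordinal k0)).
move: stop; rewrite JN0; have := rgs_memP S (lc h) eqn.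
case: rgs_mem => // none _; apply: none.
pose s j := \sum_(l < k | ix l == j) psi hP (b l) (a l) (r l).
exists (\col_i s (enum_val i)); rewrite mxE lch.
under eq_bigr => i _ do rewrite !mxE.
pose G j := lc (tnth fs j) * cprod P (expV P geV (tnth fs j))
    (expV P geV h - expV P geV (tnth fs j))%MM * s j.
rewrite -(big_enum_val (A := mem J) G) /G.
rewrite (partition_big ix (mem J)) //=.
apply: eq_bigr => j _; rewrite mulr_sumr; apply: eq_bigr => l /eqP<-.
have [_ bE] := lmg l.
rewrite -gE expg expE -!mulrA (cprod_sigma hP); do 2!congr (_ * _).
by rewrite -bE addmC addmK.
Qed.

Lemma div_loopS N st : div_loop hP S geV fs N.+1 st =
  if step st is Some st' then div_loop hP S geV fs N st' else Some st.
Proof. by []. Qed.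

(** The loop invariant.  Its last clause says lm(f_j) x^a <= lm(f) for every
    monomial x^a of q_j. *)
Definition div_inv f (st : div_state A m t) : Prop :=
  [/\ f = \sum_(j < t) vmul (tnth fs j) (st.1 j) + st.2,
      reduces P geV fs f st.2,
      oge geV (lm f) (lm st.2)
    & forall j a, coefA P a (st.1 j) != 0 ->
        exists b i, lm (tnth fs j) = Some (b, i) /\
          oge geV (lm f) (Some ((b + a)%MM, i))].

Lemma reduces_rcons f h h' :
  reduces P geV fs f h -> reduce1 P geV fs h h' -> reduces P geV fs f h'.
Proof.
move=> [s [w [w0 ws wP]]] hh'.
exists s.+1, (fun k => if (k <= s)%N then w k else h').
split=> //; first by rewrite ltnn.
move=> k; rewrite ltnS => /[dup] ks ->; move: ks; rewrite leq_eqVlt.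
case/orP=> [/eqP->|ks]; first by rewrite ltnn ws.
by rewrite ks; apply: wP.
Qed.

Lemma reduce1_lm_lt h h' E : lm h = Some E -> reduce1 P geV fs h h' ->
  forall E', lm h' = Some E' -> sgt geV E E'.
Proof.
by move=> lmh hh' E' /(lmV_coef (f := h')); apply: (reduce1_supp hP hA hV lmh hh').
Qed.

Lemma div_inv_step f st st' : div_inv f st -> step st = Some st' -> div_inv f st'.
Proof.
case: st => q h [/= fE red_f lm_h supp_q] /div_step_spec.
case=> E q' h' lmh hh' supp_q' sumE; split=> /=.
- by rewrite sumE.
- exact: reduces_rcons hh'.
- case lmh': (lm h') => [E'|]; last by case: (lm f).
  apply: (oge_trans (mV_total hV)) lm_h _; rewrite lmh /=.
  by have /andP[] := reduce1_lm_lt lmh hh' lmh'.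
- move=> j a /supp_q'[/supp_q//|[b [lmj bE]]]; exists b, E.2; split=> //.
  by rewrite bE -surjective_pairing -lmh.
Qed.

(** Induction along the well-order on monomials, applied to lm(h). *)
Lemma div_loop_ends f st : div_inv f st ->
  exists N st', [/\ div_loop hP S geV fs N st = Some st', div_inv f st'
                  & reduced P geV fs st'.2].
Proof.
have stop st1 : div_inv f st1 -> step st1 = None ->
  exists N st', [/\ div_loop hP S geV fs N st1 = Some st', div_inv f st'
                  & reduced P geV fs st'.2].
  move=> inv_st stop; exists 1%N, st1; rewrite div_loopS stop; split=> //.
  by case: st1 stop {inv_st} => q h; apply: div_step_stop.
case lm_st: (lm st.2) => [E|]; last first.
  move=> inv_st; apply: stop => //.
  case: st lm_st {inv_st} => q h /= /(lmV_None hV)->; by rewrite /div_step eqxx.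
elim/(well_founded_ind (sgt_wf hV)): E st lm_st => E IH [q h] /= lmh inv_st.
case step_st: (step (q, h)) => [st'|]; last exact: stop.
suff [N [st2 [loop_st' inv' red']]] : exists N st2,
    [/\ div_loop hP S geV fs N st' = Some st2, div_inv f st2
      & reduced P geV fs st2.2].
  by exists N.+1, st2; rewrite div_loopS step_st.
have := div_inv_step inv_st step_st.
case/div_step_spec: step_st => E1 q' h' lmh1 hh' _ _.
case lmh': (lm h') => [E'|].
  apply: (IH E') => //; apply: (reduce1_lm_lt lmh) lmh'.
  exact: hh'.
move=> inv'; apply: stop => //.
by move/(lmV_None hV): lmh' => ->; rewrite /div_step eqxx.
Qed.

(** The invariant gives that lm(f) bounds the maximum.  Conversely some f_j q_j or
    [h] contains lm(f), and by compatibility lm(f_j) lm(q_j) bounds the monomials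
    of f_j q_j. *)
Lemma lm_division f q h : compatible_orders geA geV -> div_inv f (q, h) ->
  lm f = omax geV
    (\big[omax geV/None]_(j < t)
       lm (vmul (valV P (lm (tnth fs j))) (valA P (lmA P geA (q j))))) (lm h).
Proof.
move=> compat [/= fE _ lm_h supp_q]; have totV := mV_total hV.
pose L j := lm (vmul (valV P (lm (tnth fs j))) (valA P (lmA P geA (q j)))).
have LP j : (L j = None /\ vmul (tnth fs j) (q j) = 0) \/ exists2 X, L j = Some X
    & oge geV (lm f) (Some X) /\ supported P (geV X) (vmul (tnth fs j) (q j)).
  rewrite /L; case lmq: (lmA P geA (q j)) => [a|] /=; last first.
    by left; rewrite vmul0 (lmA_None hA lmq) vmul0; split=> //; apply/(lmV_None hV).
  right; have [b [i [lmj ge_f]]] := supp_q j a (lmA_coef lmq).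
  have R_neq0 := lmV_nontrivial lmj.
  exists ((b + a)%MM, i); first by rewrite lmj; exact: (lmV_vmul_mon hP hA hV).
  by split=> //; exact: (supported_vmul hP hA hV).
apply: (oge_anti totV).
  case: (omax_eq geV (\big[omax geV/None]_(j < t) L j) (lm h)) => -> //.
  case E: (\big[omax geV/None]_(j < t) L j) => [X|]; last by case: (lm f).
  have [j _ Lj] := bigomax_Some E.
  by case: (LP j) => [[]|[Y]]; rewrite Lj // => -[<-] [].
case lmf: (lm f) => [X|]; last by case: (omax _ _ _).
have := lmV_coef lmf; apply: contraR; rewrite (oge_omax totV) negb_or.
move=> /andP[notL noth]; rewrite fE raddfD raddf_sum /=.
have -> : coefV P X h = 0.
  by apply/eqP; apply: contraNT noth => /(lmV_ub hV).
rewrite addr0; apply/eqP; rewrite big1 // => j _; apply/eqP.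
case: (LP j) => [[_ ->]|[Y Lj [_ suppY]]]; first by rewrite raddf0.
apply: contraNT notL => /suppY YX; apply: (oge_bigomax totV).
by exists j; rewrite ?mem_index_enum // -/(L j) Lj.
Qed.

End DivisionAlgorithm.

Theorem theorem3p8 (R A : pzRingType) (n m t : nat) (P : skewPBW R A n)
  (hP : bijective_ext P) (S : RGS R) (hm : (0 < m)%N)
  (geA : rel 'X_{1..n}) (geV : rel ('X_{1..n} * 'I_m)%type)
  (hA : monomial_orderA P geA) (hV : monomial_orderV P geA geV)
  (fs : t.-tuple 'cV[A]_m) (hfs : forall j, tnth fs j <> 0) (f : 'cV[A]_m) :
  exists (q : {ffun 'I_t -> A}) (h : 'cV[A]_m),
    [/\ division_output hP S geV fs f q h,
        reduced P geV fs h,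
        reduces P geV fs f h,
        f = \sum_(j < t) vmul (tnth fs j) (q j) + h
      & compatible_orders geA geV ->
        lmV P geV f =
          omax geV
            (\big[omax geV/None]_(j < t)
               lmV P geV (vmul (valV P (lmV P geV (tnth fs j)))
                               (valA P (lmA P geA (q j)))))
            (lmV P geV h)].
Proof.
have inv0 : div_inv P geV fs f ([ffun=> 0], f).
  split=> /=.
  - by rewrite big1 ?add0r // => j _; rewrite ffunE vmul0.
  - by exists 0%N, (fun=> f).
  - exact: oge_refl (mV_total hV) _.
  - by move=> j a; rewrite ffunE raddf0 eqxx.
have [N [[q h] [loopN inv red]]] := div_loop_ends hP S hA hV inv0.
exists q, h; have [fE red_f _ _] := inv; split=> //; first by exists N.
by move=> compat; apply: lm_division.
Qed.
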